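(* Let $R$ be a ring and let $\mathfrak{X}$ be a class of left $R$-modules that contains all projective left $R$-modules. If $(M_i)_{i\in I}$ is a family of left $R$-modules, then $$\mathfrak{X}\text{-}\mathrm{Gpd}\Big(\bigoplus_{i\in I}M_i\Big)=\sup\{\mathfrak{X}\text{-}\mathrm{Gpd}(M_i)\mid i\in I\}.$$
   Context: $R$ is a non-trivial associative ring with identity; all modules are unital left $R$-modules. A module $G$ is called $\mathfrak{X}$-Gorenstein projective if there is an exact sequence $\cdots\to P_1\to P_0\to P^0\to P^1\to\cdots$ of projective modules which remains exact after applying $\mathrm{Hom}_R(-,X)$ for every $X\in\mathfrak{X}$, and such that $G=\mathrm{Ker}(P_0\to P^0)$ (up to isomorphism). For a module $M$, $\mathfrak{X}\text{-}\mathrm{Gpd}(M)$ is the infimum of all integers $n\ge 0$ for which there is an exact sequence $0\to G_n\to\cdots\to G_1\to G_0\to M\to 0$ with all $G_i$ $\mathfrak{X}$-Gorenstein projective, and $\mathfrak{X}\text{-}\mathrm{Gpd}(M)=\infty$ if there is no such $n$. Suprema are taken in $\{0,1,2,\dots\}\cup\{\infty\}$. *)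

(* Defs.v *)
From HB Require Import structures.
From mathcomp Require Import all_boot all_order all_algebra.
From mathcomp Require Import boolp classical_sets functions cardinality.

Set Implicit Arguments.
Unset Strict Implicit.
Unset Printing Implicit Defensive.

Import GRing.Theory.

Local Open Scope classical_set_scope.
Local Open Scope ring_scope.

(* The totally ordered set {0, 1, 2, ...} U {oo}. *)
Variant natbar := Nfin of nat | Ninf.

Definition le_natbar (x y : natbar) : Prop :=
  match x, y with
  | _, Ninf => True
  | Ninf, Nfin _ => False
  | Nfin m, Nfin n => (m <= n)%N
  end.

(* The infimum of the empty set is oo. *)
Definition natbar_inf (A : set nat) : natbar :=
  if pselect (exists n, `[< A n >]) is left exA then Nfin (ex_minn exA)
  else Ninf.

(* The least upper bound in natbar; the supremum of the empty set is 0. *)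
Definition natbar_sup (S : set natbar) : natbar :=
  natbar_inf [set n | forall x, S x -> le_natbar x (Nfin n)].

Lemma natbar_inf_lb (A : set nat) n : A n -> le_natbar (natbar_inf A) (Nfin n).
Proof.
move=> An; rewrite /natbar_inf; case: pselect => [exA|[]] /=.
  by case: ex_minnP => m _; apply; apply/asboolP.
by exists n; apply/asboolP.
Qed.

Lemma natbar_inf_glb (A : set nat) x :
  (forall n, A n -> le_natbar x (Nfin n)) -> le_natbar x (natbar_inf A).
Proof.
move=> lbx; rewrite /natbar_inf; case: pselect => [exA|_]; last by case: x lbx.
by case: ex_minnP => m /asboolP /lbx.
Qed.

Lemma natbar_sup_ub (S : set natbar) x : S x -> le_natbar x (natbar_sup S).
Proof. by move=> Sx; apply: natbar_inf_glb => n; apply. Qed.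

Lemma natbar_sup_lub (S : set natbar) y :
  (forall x, S x -> le_natbar x y) -> le_natbar (natbar_sup S) y.
Proof.
by case: y => [n|] uby; [apply: natbar_inf_lb | case: (natbar_sup S)].
Qed.

Section DirectSum.
Variables (R : nzRingType) (I : Type) (M : I -> lmodType R).

Definition dirprod := forall i, M i.

HB.instance Definition _ := Choice.on dirprod.

Fact dirprod_addA : associative (fun f g : dirprod => (fun i => f i + g i) : dirprod).
Proof. by move=> f g h; apply: functional_extensionality_dep => i; rewrite addrA. Qed.

Fact dirprod_addC : commutative (fun f g : dirprod => (fun i => f i + g i) : dirprod).
Proof. by move=> f g; apply: functional_extensionality_dep => i; rewrite addrC. Qed.

Fact dirprod_add0 :
  left_id ((fun=> 0) : dirprod) (fun f g : dirprod => (fun i => f i + g i) : dirprod).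
Proof. by move=> f; apply: functional_extensionality_dep => i; rewrite add0r. Qed.

Fact dirprod_addN : left_inverse ((fun=> 0) : dirprod)
  (fun f : dirprod => (fun i => - f i) : dirprod)
  (fun f g : dirprod => (fun i => f i + g i) : dirprod).
Proof. by move=> f; apply: functional_extensionality_dep => i; rewrite addNr. Qed.

HB.instance Definition _ :=
  GRing.isZmodule.Build dirprod dirprod_addA dirprod_addC dirprod_add0 dirprod_addN.

Definition dirprod_scale (a : R) (f : dirprod) : dirprod := fun i => a *: f i.

Fact dirprod_scaleA a b f :
  dirprod_scale a (dirprod_scale b f) = dirprod_scale (a * b) f.
Proof. by apply: functional_extensionality_dep => i; rewrite /dirprod_scale scalerA. Qed.

Fact dirprod_scale1 : left_id 1 dirprod_scale.
Proof. by move=> f; apply: functional_extensionality_dep => i; rewrite /dirprod_scale scale1r. Qed.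

Fact dirprod_scaleDr : right_distributive dirprod_scale +%R.
Proof. by move=> a f g; apply: functional_extensionality_dep => i; apply: scalerDr. Qed.

Fact dirprod_scaleDl f : {morph dirprod_scale^~ f : a b / a + b}.
Proof. by move=> a b; apply: functional_extensionality_dep => i; apply: scalerDl. Qed.

HB.instance Definition _ := GRing.Zmodule_isLmodule.Build R dirprod
  dirprod_scaleA dirprod_scale1 dirprod_scaleDr dirprod_scaleDl.

Definition dirprod_finsupp : {pred dirprod} :=
  fun f => `[< finite_set [set i | f i != 0] >].

Fact dirprod_finsupp_submod_closed : submod_closed dirprod_finsupp.
Proof.
split.
  apply/asboolP; apply: (sub_finite_set _ (finite_set0 I)) => i /=.
  by rewrite eqxx.
move=> a f g /asboolP finf /asboolP fing; apply/asboolP.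
apply: (@sub_finite_set _ _ ([set i | f i != 0] `|` [set i | g i != 0])).
  move=> i /= nz; case: (eqVneq (f i) 0) => fi; last by left.
  by right; move: nz; rewrite [X in X != _](_ : _ = a *: f i + g i)// fi scaler0 add0r.
by rewrite finite_setU.
Qed.

HB.instance Definition _ :=
  GRing.isSubmodClosed.Build R dirprod dirprod_finsupp dirprod_finsupp_submod_closed.

(* The direct sum: families (x_i) in the product with finitely many nonzero
   entries. *)
Record dirsum := DirSum { dirsum_val : dirprod; _ : dirsum_val \in dirprod_finsupp }.

HB.instance Definition _ := [isSub for dirsum_val].
HB.instance Definition _ := [Choice of dirsum by <:].
HB.instance Definition _ := [SubChoice_isSubLmodule of dirsum by <:].

End DirectSum.

Section GorensteinProjective.
Variable R : nzRingType.

Definition surjective_map (A B : Type) (f : A -> B) : Prop :=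
  forall b, exists a, f a = b.

Definition projective (P : lmodType R) : Prop :=
  forall (A B : lmodType R) (g : {linear A -> B}) (f : {linear P -> B}),
    surjective_map g -> exists h : {linear P -> A}, forall x, g (h x) = f x.

(* A --u--> B --v--> C is exact at B. *)
Definition exact (A B C : lmodType R) (u : {linear A -> B})
    (v : {linear B -> C}) : Prop :=
  forall b, v b = 0 <-> exists a, u a = b.

(* Hom(C, X) --(_ \o v)--> Hom(B, X) --(_ \o u)--> Hom(A, X) is exact at
   Hom(B, X). *)
Definition hom_exact (X A B C : lmodType R) (u : {linear A -> B})
    (v : {linear B -> C}) : Prop :=
  forall f : {linear B -> X},
    (forall a, f (u a) = 0) <->
    (exists h : {linear C -> X}, forall b, h (v b) = f b).

(* i is an isomorphism from G onto Ker f. *)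
Definition iso_onto_ker (G A B : lmodType R) (i : {linear G -> A})
    (f : {linear A -> B}) : Prop :=
  injective i /\ exact i f.

(* In the sequence ... -> P_1 -> P_0 -> P^0 -> P^1 -> ..., the modules P_n and
   P^n are Pl n and Pr n, and dl n : P_{n+1} -> P_n, c : P_0 -> P^0,
   dr n : P^n -> P^{n+1}. *)
Definition Gproj (XX : lmodType R -> Prop) (G : lmodType R) : Prop :=
  exists (Pl Pr : nat -> lmodType R)
         (dl : forall n, {linear Pl n.+1 -> Pl n})
         (c : {linear Pl 0%N -> Pr 0%N})
         (dr : forall n, {linear Pr n -> Pr n.+1}),
    [/\ (forall n, projective (Pl n)) /\ (forall n, projective (Pr n)),
        [/\ forall n, exact (dl n.+1) (dl n),
            exact (dl 0%N) c,
            exact c (dr 0%N) &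
            forall n, exact (dr n) (dr n.+1)],
        forall X, XX X ->
          [/\ forall n, hom_exact X (dl n.+1) (dl n),
              hom_exact X (dl 0%N) c,
              hom_exact X c (dr 0%N) &
              forall n, hom_exact X (dr n) (dr n.+1)] &
        exists i : {linear G -> Pl 0%N}, iso_onto_ker i c].

(* There is an exact sequence 0 -> G_n -> ... -> G_0 -> M -> 0 with every G_k
   in Gproj XX; it is written as an infinite sequence with G_k = 0 for k > n. *)
Definition Gproj_resolution (XX : lmodType R -> Prop) (M : lmodType R)
    (n : nat) : Prop :=
  exists (G : nat -> lmodType R)
         (d : forall k, {linear G k.+1 -> G k})
         (e : {linear G 0%N -> M}),
    [/\ forall k, (k <= n)%N -> Gproj XX (G k),
        forall k, (n < k)%N -> forall x : G k, x = 0,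
        forall k, exact (d k.+1) (d k),
        exact (d 0%N) e &
        surjective_map e].

Definition Gpd (XX : lmodType R -> Prop) (M : lmodType R) : natbar :=
  natbar_inf [set n | Gproj_resolution XX M n].

End GorensteinProjective.

(* Main.v *)
Require Import Defs.
From HB Require Import structures.
From mathcomp Require Import all_boot all_algebra.
From mathcomp Require Import generic_quotient ring_quotient.
From mathcomp Require Import boolp classical_sets cardinality.

Set Implicit Arguments.
Unset Strict Implicit.
Unset Printing Implicit Defensive.

Import GRing.Theory.

Local Open Scope classical_set_scope.
Local Open Scope ring_scope.

(** Fix n; the claim is that the direct sum has dimension at most n exactly when
every M_i has.

If every M_i has a resolution of length n, so has the sum: direct sums preserve
exactness and projectivity, and since Hom(-, X) turns sums into products, a sum
of Hom(-, X)-exact complexes is again one ([Gproj_dirsum],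
[Gdim_le_dirsum]).

Conversely, M_i is a retract of the sum, so it is enough that retracts do not
increase the dimension ([Gdim_le_retract]). This needs three closure properties
of the class of X-Gorenstein projective modules, all derived from a coinductive
description of it: it is the largest class W of modules C such that
Ext^1(C, X) = 0 for every X in XX, C is a quotient of a projective module with
kernel in W, and C embeds in a projective module with cokernel in W
([Gproj_orthogonal], [Gproj_left], [Gproj_right], [Gproj_coind]). Working with
W, one never handles a whole complex, only short exact sequences.

- Extensions 0 -> A -> B -> C -> 0 ([Gproj_extension]): the horseshoe
  construction on either side. To embed B one extends A -> P along A -> B, where
  A -> P is the given embedding of A in a projective P; this is possible because
  P is in XX, so Ext^1(C, P) = 0.
- Retracts ([Gproj_retract]): if C is a retract of D and
  0 -> D -> P -> Q -> 0 is exact, the cokernel N of C -> D -> P need not be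
  visibly good, but N x C is an extension of Q by D. Hence N is again a retract
  of a module in the class. The other side is similar.
- Kernels of epimorphisms A -> B ([Gproj_kernel]): for a projective Q mapping
  onto B, the pullback of A and Q over B is an extension of A, and the kernel
  splits off from it.

For the dimension, let D have a resolution of length n + 1, let P be projective
with a map q onto D, and let s : C -> D, r : D -> C with r s = 1. Then
(x, y) |-> s r q x + (q y - s r q y) maps P x P onto D. Its kernel has dimension
at most n ([Gdim_le_syzygy]) and has the kernel of r q : P -> C as a retract, so
induction applies. *)

(** * Kernels, cokernels and short exact sequences *)

Section Modules.
Variable R : nzRingType.
Implicit Types A B C D G K M N P Q X Y Z : lmodType R.

Definition linear_of A B (f : A -> B) (lf : linear f) : {linear A -> B} :=
  HB.pack f (GRing.isLinear.Build R A B *:%R f lf).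

Lemma linear_inj A B (f : {linear A -> B}) :
  (forall x, f x = 0 -> x = 0) -> injective f.
Proof.
move=> f0 x y e; apply/eqP; rewrite -subr_eq0; apply/eqP/f0.
by rewrite linearB /= e subrr.
Qed.

Section Pairing.
Variables A B C : lmodType R.

Definition pair_map (f : {linear A -> B}) (g : {linear A -> C}) (x : A) :
  B * C := (f x, g x).

Fact pair_map_is_linear f g : linear (pair_map f g).
Proof. by move=> a x y; rewrite /pair_map !linearP. Qed.

HB.instance Definition _ f g :=
  GRing.isLinear.Build R A (B * C)%type *:%R (pair_map f g)
    (pair_map_is_linear f g).

Definition copair_map (f : {linear A -> C}) (g : {linear B -> C})
  (x : A * B) : C := f x.1 + g x.2.

Fact copair_map_is_linear f g : linear (copair_map f g).
Proof.
by move=> a x y; rewrite /copair_map /= !linearP scalerDr addrACA.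
Qed.

HB.instance Definition _ f g :=
  GRing.isLinear.Build R (A * B)%type C *:%R (copair_map f g)
    (copair_map_is_linear f g).

End Pairing.

Section Cokernel.
Variables (A B : lmodType R) (u : {linear A -> B}).

Definition im_pred : {pred B} := fun b => `[< exists a, u a = b >].

Fact im_pred_submod_closed : submod_closed im_pred.
Proof.
split; first by apply/asboolP; exists 0; rewrite linear0.
move=> a _ _ /asboolP[x <-] /asboolP[y <-]; apply/asboolP.
by exists (a *: x + y); rewrite linearP.
Qed.

HB.instance Definition _ :=
  GRing.isSubmodClosed.Build R B im_pred im_pred_submod_closed.

(** The additive quotient group comes with [ring_quotient]; over a
noncommutative ring only the action of the scalars has to be added. *)
Definition coker : Type := Quotient.quot im_pred.
HB.instance Definition _ := GRing.Zmodule.on coker.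

Local Open Scope quotient_scope.

Definition coker_proj (b : B) : coker := \pi_(Quotient.quot im_pred) b.

Lemma coker_proj_eq b b' :
  (coker_proj b = coker_proj b') <-> exists a, u a = b - b'.
Proof.
have E : (coker_proj b == coker_proj b') = (b - b' \in im_pred).
  by rewrite /coker_proj piE Quotient.equivE.
split=> [/eqP|h]; first by rewrite E => /asboolP.
by apply/eqP; rewrite E; apply/asboolP.
Qed.

Lemma coker_proj_repr (q : coker) :
  coker_proj (repr (q : Quotient.quot im_pred)) = q.
Proof. exact: reprK. Qed.

Lemma coker_projD b b' : coker_proj (b + b') = coker_proj b + coker_proj b'.
Proof. by rewrite /coker_proj !piE. Qed.

Definition coker_scale (r : R) (q : coker) : coker :=
  coker_proj (r *: repr (q : Quotient.quot im_pred)).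

Lemma coker_scale_proj r b : coker_scale r (coker_proj b) = coker_proj (r *: b).
Proof.
apply/coker_proj_eq.
have /coker_proj_eq[a ha] := coker_proj_repr (coker_proj b).
by exists (r *: a); rewrite linearZ /= ha scalerBr.
Qed.

Fact coker_scaleA a b q :
  coker_scale a (coker_scale b q) = coker_scale (a * b) q.
Proof. by rewrite -(coker_proj_repr q) !coker_scale_proj scalerA. Qed.

Fact coker_scale1 : left_id 1 coker_scale.
Proof. by move=> q; rewrite -(coker_proj_repr q) coker_scale_proj scale1r. Qed.

Fact coker_scaleDr : right_distributive coker_scale +%R.
Proof.
move=> a p q; rewrite -(coker_proj_repr p) -(coker_proj_repr q).
by rewrite !(coker_scale_proj, =^~ coker_projD) scalerDr.
Qed.

Fact coker_scaleDl q : {morph coker_scale^~ q : a b / a + b}.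
Proof.
move=> a b; rewrite -(coker_proj_repr q).
by rewrite !(coker_scale_proj, =^~ coker_projD) scalerDl.
Qed.

HB.instance Definition _ := GRing.Zmodule_isLmodule.Build R coker
  coker_scaleA coker_scale1 coker_scaleDr coker_scaleDl.

Fact coker_proj_is_linear : linear coker_proj.
Proof.
by move=> a x y; rewrite coker_projD -coker_scale_proj.
Qed.

HB.instance Definition _ :=
  GRing.isLinear.Build R B coker *:%R coker_proj coker_proj_is_linear.

End Cokernel.

Section Kernel.
Variables (A B : lmodType R) (v : {linear A -> B}).

Definition ker_pred : {pred A} := fun a => v a == 0.

Fact ker_pred_submod_closed : submod_closed ker_pred.
Proof.
split; first by rewrite unfold_in linear0.
move=> a x y; rewrite !unfold_in => /eqP vx /eqP vy.
by rewrite linearP vx vy scaler0 addr0.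
Qed.

HB.instance Definition _ :=
  GRing.isSubmodClosed.Build R A ker_pred ker_pred_submod_closed.

Record kernel := Kernel { kernel_val : A; _ : kernel_val \in ker_pred }.

HB.instance Definition _ := [isSub for kernel_val].
HB.instance Definition _ := [Choice of kernel by <:].
HB.instance Definition _ := [SubChoice_isSubLmodule of kernel by <:].

End Kernel.

Definition ses A B C (u : {linear A -> B}) (v : {linear B -> C}) : Prop :=
  [/\ injective u, exact u v & surjective_map v].

Lemma ses0 A B C (u : {linear A -> B}) (v : {linear B -> C}) a :
  ses u v -> v (u a) = 0.
Proof. by case=> _ ex _; apply/ex; exists a. Qed.

Lemma cokernel_exists A B (u : {linear A -> B}) : injective u ->
  exists C (v : {linear B -> C}), ses u v.
Proof.
move=> inj; exists (coker u), (coker_proj u : {linear _ -> _}); split=> //.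
  move=> b; rewrite -(linear0 (coker_proj u)); split.
    by move/coker_proj_eq; rewrite subr0.
  by move=> h; apply/coker_proj_eq; rewrite subr0.
by move=> q; exists (repr (q : Quotient.quot (im_pred u))); exact: coker_proj_repr.
Qed.

Lemma kernel_exists A B (v : {linear A -> B}) :
  exists K (u : {linear K -> A}), injective u /\ exact u v.
Proof.
exists (kernel v), (\val : {linear kernel v -> A}); split; first exact: val_inj.
move=> a; split=> [va|[[k /eqP vk] <-]] //.
have ka : a \in ker_pred v by apply/eqP.
by exists (Kernel ka).
Qed.

Lemma kernel_ses A B (v : {linear A -> B}) : surjective_map v ->
  exists K (u : {linear K -> A}), ses u v.
Proof. by move=> sv; have [K [u [? ?]]] := kernel_exists v; exists K, u. Qed.

Lemma factor_inj A B C (u : {linear A -> B}) (f : {linear C -> B}) :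
  injective u -> (forall c, exists a, u a = f c) ->
  exists g : {linear C -> A}, forall c, u (g c) = f c.
Proof.
move=> inj h; have [g gP] := choice h.
have lg : linear g by move=> a x y; apply: inj; rewrite linearP !gP linearP.
by exists (linear_of lg).
Qed.

Lemma factor_surj A B C (v : {linear A -> B}) (f : {linear A -> C}) :
  surjective_map v -> (forall a, v a = 0 -> f a = 0) ->
  exists g : {linear B -> C}, forall a, g (v a) = f a.
Proof.
move=> sv h; have [s sP] := choice sv.
have fE a a' : v a = v a' -> f a = f a'.
  by move=> e; apply/eqP; rewrite -subr_eq0 -linearB h // linearB /= e subrr.
have lg : linear (f \o s).
  by move=> a x y; rewrite /= -linearP; apply: fE; rewrite linearP !sP.
by exists (linear_of lg) => a; apply: fE; rewrite sP.
Qed.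

Lemma projective_pair P Q : projective P -> projective Q ->
  projective (P * Q)%type.
Proof.
move=> pP pQ A B g f sg.
have [h hP] := pP A B g (f \o pair_map idfun \0 : {linear _ -> _}) sg.
have [k kP] := pQ A B g (f \o pair_map \0 idfun : {linear _ -> _}) sg.
exists (copair_map h k : {linear _ -> _}) => -[x y].
rewrite linearD /= hP kP /= -linearD /=; congr (f _).
by rewrite /pair_map /= -[LHS]/(x + 0, 0 + y) addr0 add0r.
Qed.

Lemma projective_trivial Z : (forall z : Z, z = 0) -> projective Z.
Proof.
by move=> z0 A B g f sg; exists \0 => x /=; rewrite (z0 x) !linear0.
Qed.

Lemma trivial_exists : exists Z, forall z : Z, z = 0.
Proof.
have [K [u [inj ex]]] := kernel_exists (idfun : {linear R^o -> R^o}).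
exists K => z; apply: inj; rewrite linear0.
by have : idfun (u z) = 0 by apply/ex; exists z.
Qed.

End Modules.

(** * The class of Gorenstein projective modules as a greatest fixed point *)

Section Gorenstein.
Variables (R : nzRingType) (XX : lmodType R -> Prop).
Implicit Types A B C D G K M N P Q X Y Z : lmodType R.

Definition scons T (x : T) (s : nat -> T) (n : nat) : T :=
  if n is m.+1 then s m else x.

Definition cochain_cons A (M : nat -> lmodType R) (f : {linear A -> M 0%N})
    (d : forall n, {linear M n -> M n.+1}) n :
    {linear scons A M n -> scons A M n.+1} :=
  match n with 0%N => f | m.+1 => d m end.

Definition chain_cons A (M : nat -> lmodType R) (f : {linear M 0%N -> A})
    (d : forall n, {linear M n.+1 -> M n}) n :
    {linear scons A M n.+1 -> scons A M n} :=
  match n with 0%N => f | m.+1 => d m end.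

Definition extendable A B (u : {linear A -> B}) : Prop :=
  forall X, XX X -> forall f : {linear A -> X},
  exists h : {linear B -> X}, forall a, h (u a) = f a.

(** The vanishing of Ext^1(C, X) for every X in XX: applied to
0 -> X -> B -> C -> 0 and the identity of X, the condition splits the
extension. *)
Definition ext_orthogonal C : Prop :=
  forall A B (u : {linear A -> B}) (v : {linear B -> C}),
  ses u v -> extendable u.

(** Ext^1(C, X) is the cokernel of Hom(P, X) -> Hom(K, X), so one projective
presentation of C decides its vanishing. In the proof, B is a quotient of
A x P. *)
Lemma ext_orthogonal_presentation K P C (u : {linear K -> P})
    (v : {linear P -> C}) :
  ses u v -> projective P -> extendable u -> ext_orthogonal C.
Proof.
move=> [uI uv vS] pP uX A B i p [iI ip pS] X XXX f.
have [l lP] := pP B C p v pS.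
have [k kP] : exists k : {linear K -> A}, forall x, i (k x) = l (u x).
  have [|k kP] := @factor_inj _ _ _ _ i (l \o u : {linear _ -> _}) iI.
    by move=> x; apply/ip; rewrite /= lP; apply/uv; exists x.
  by exists k.
have [h hP] := uX X XXX (f \o k : {linear _ -> _}).
have [||g gP] := @factor_surj _ _ _ _ (copair_map i l : {linear _ -> _})
    (copair_map f h : {linear _ -> _}).
- move=> b; have [x xb] := vS (p b).
  have /ip[a ab] : p (b - l x) = 0 by rewrite linearB /= lP xb subrr.
  by exists (a, x); rewrite /= /copair_map /= ab subrK.
- move=> [a x]; rewrite /= /copair_map /= => e.
  have /uv[y yx] : v x = 0.
    have := congr1 p e; rewrite linearD /= lP linear0 (_ : p (i a) = 0) ?add0r//.
    by apply/ip; exists a.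
  have ak : a + k y = 0 by apply: iI; rewrite linearD /= kP yx e linear0.
  by rewrite -yx hP /= -linearD ak linear0.
- by exists g => a; have := gP (a, 0); rewrite /= /copair_map /= !linear0 !addr0.
Qed.

(** The complex obtained by splicing Y -> A, A -> B -> C, C -> Z is exact at B,
and by the next lemma remains so under Hom(-, X). *)
Lemma splice_exact A B C Y Z (w : {linear Y -> A}) (u : {linear A -> B})
    (v : {linear B -> C}) (t : {linear C -> Z}) :
  surjective_map w -> ses u v -> injective t ->
  exact (u \o w : {linear _ -> _}) (t \o v : {linear _ -> _}).
Proof.
move=> wS [uI uv vS] tI b; split=> [/= tvb|[y <-] /=].
  have /uv[a <-] : v b = 0 by apply: tI; rewrite tvb linear0.
  by have [y <-] := wS a; exists y.
by rewrite (_ : v _ = 0) ?linear0//; apply/uv; exists (w y).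
Qed.

Lemma splice_hom_exact A B C Y Z (w : {linear Y -> A}) (u : {linear A -> B})
    (v : {linear B -> C}) (t : {linear C -> Z}) X :
  surjective_map w -> ses u v -> extendable t -> XX X ->
  hom_exact X (u \o w : {linear _ -> _}) (t \o v : {linear _ -> _}).
Proof.
move=> wS uvS tE XXX f; split=> [fuw|[h hP] y]; last first.
  by rewrite -hP /= (ses0 _ uvS) !linear0.
have [uI uv vS] := uvS.
have [b|g gP] := @factor_surj _ _ _ _ v f vS.
  by move=> /uv[a <-]; have [y <-] := wS a; exact: fuw.
by have [h hP] := tE X XXX g; exists h => b; rewrite /= hP gP.
Qed.

(** The complete resolution of G, shifted by one place, is a complete resolution
of the kernel of the projective module that maps onto G; shifting in the other
direction gives [Gproj_right]. *)
Lemma Gproj_left G : Gproj XX G ->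
  exists K P (u : {linear K -> P}) (v : {linear P -> G}),
  [/\ ses u v, projective P, Gproj XX K & extendable u].
Proof.
move=> [Pl [Pr [dl [c [dr [[pl pr] [e1 e2 e3 e4] hX [i [iI ic]]]]]]]].
have [K [u [uI uv]]] := kernel_exists (dl 0%N).
have [v vP] : exists v : {linear Pl 1%N -> G}, forall x, i (v x) = dl 0%N x.
  by apply: factor_inj => // x; apply/ic/e2; exists x.
have uvS : ses u v.
  split=> // [b|g].
    apply: (iff_trans _ (uv b)); rewrite -vP; split=> [->|]; first exact: linear0.
    by move=> e; apply: iI; rewrite e linear0.
  have /e2[b bP] : c (i g) = 0 by apply/ic; exists g.
  by exists b; apply: iI; rewrite vP.
exists K, (Pl 1%N), u, v; split=> //.
  exists (Pl \o succn), (scons (Pl 0%N) Pr).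
  exists (fun n => dl n.+1), (dl 0%N).
  exists (cochain_cons c dr).
  split; last by exists u.
  - by split=> [n|[|n]] /=.
  - by split=> [n|||[|n]]; [apply: e1|apply: e1|apply: e2|apply: e3|apply: e4].
  - move=> X /hX[h1 h2 h3 h4]; split=> [n|||[|n]];
      [exact: h1|exact: h1|exact: h2|exact: h3|exact: h4].
move=> X /hX[h1 _ _ _] f.
have [w wP] : exists w : {linear Pl 2%N -> K}, forall x, u (w x) = dl 1%N x.
  by apply: factor_inj => // x; apply/uv/e1; exists x.
have [h hP] : exists h : {linear Pl 1%N -> X}, forall b, h (dl 1%N b) = f (w b).
  apply/(h1 _ (f \o w : {linear _ -> _})) => a /=.
  rewrite (_ : w _ = 0) ?linear0//; apply: uI; rewrite wP linear0.
  by apply/e1; exists a.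
exists h => k; have /e1[b bk] : dl 0%N (u k) = 0 by apply/uv; exists k.
by rewrite -bk hP; congr (f _); apply: uI; rewrite wP.
Qed.

Lemma Gproj_right G : Gproj XX G ->
  exists P C (u : {linear G -> P}) (v : {linear P -> C}),
  [/\ ses u v, projective P & Gproj XX C].
Proof.
move=> [Pl [Pr [dl [c [dr [[pl pr] [e1 e2 e3 e4] hX [i [iI ic]]]]]]]].
have [C [j [jI jd]]] := kernel_exists (dr 0%N).
have [v vP] : exists v : {linear Pl 0%N -> C}, forall x, j (v x) = c x.
  by apply: factor_inj => // x; apply/jd/e3; exists x.
exists (Pl 0%N), C, i, v; split=> //.
  split=> // [b|y].
    apply: (iff_trans _ (ic b)); rewrite -vP; split=> [->|]; first exact: linear0.
    by move=> e; apply: jI; rewrite e linear0.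
  have /e3[b bP] : dr 0%N (j y) = 0 by apply/jd; exists y.
  by exists b; apply: jI; rewrite vP.
exists (scons (Pr 0%N) Pl), (Pr \o succn).
exists (chain_cons c dl).
exists (dr 0%N), (fun n => dr n.+1); split; last by exists j.
- by split=> [[|n]|n] /=.
- by split=> [[|n]|||n]; [apply: e2|apply: e1|apply: e3|apply: e4|apply: e4].
- move=> X /hX[h1 h2 h3 h4]; split=> [[|n]|||n];
    [exact: h2|exact: h1|exact: h3|exact: h4|exact: h4].
Qed.

Lemma Gproj_orthogonal G : Gproj XX G -> ext_orthogonal G.
Proof.
move=> /Gproj_left[K [P [u [v [s pP _ uE]]]]].
exact: ext_orthogonal_presentation s pP uE.
Qed.

(** A bare diagram, without exactness: packing the modules and the maps together
lets one choice pick them for all members of a family. *)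
Record precover G := Precover {
  pc_ker : lmodType R;
  pc_mid : lmodType R;
  pc_in : {linear pc_ker -> pc_mid};
  pc_out : {linear pc_mid -> G} }.

Record preenvelope G := Preenvelope {
  pe_mid : lmodType R;
  pe_coker : lmodType R;
  pe_in : {linear G -> pe_mid};
  pe_out : {linear pe_mid -> pe_coker} }.

Section Coinduction.
Variable W : lmodType R -> Prop.
Hypothesis W_orthogonal : forall G, W G -> ext_orthogonal G.
Hypothesis W_left : forall G, W G ->
  exists K P (u : {linear K -> P}) (v : {linear P -> G}),
  [/\ ses u v, projective P & W K].
Hypothesis W_right : forall G, W G ->
  exists P C (u : {linear G -> P}) (v : {linear P -> C}),
  [/\ ses u v, projective P & W C].

(** Iterating [W_left] and [W_right] from G and splicing gives an exact complex
of projectives. Each monomorphism in it has its cokernel in W, so maps extend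
along it and the complex is Hom(-, X)-exact. *)
Lemma Gproj_coind G : W G -> Gproj XX G.
Proof.
pose T := {G | W G}.
have L (t : T) : {p : precover (sval t) |
    [/\ ses (pc_in p) (pc_out p), projective (pc_mid p) & W (pc_ker p)]}.
  apply: cid; have [K [P [u [v s]]]] := W_left (svalP t).
  by exists (Precover u v).
have E (t : T) : {p : preenvelope (sval t) |
    [/\ ses (pe_in p) (pe_out p), projective (pe_mid p) & W (pe_coker p)]}.
  apply: cid; have [P [C [u [v s]]]] := W_right (svalP t).
  by exists (Preenvelope u v).
have LW t : W (pc_ker (sval (L t))) by case: (svalP (L t)).
have EW t : W (pe_coker (sval (E t))) by case: (svalP (E t)).
have LS t : ses (pc_in (sval (L t))) (pc_out (sval (L t))).
  by case: (svalP (L t)).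
have ES t : ses (pe_in (sval (E t))) (pe_out (sval (E t))).
  by case: (svalP (E t)).
have LP t : projective (pc_mid (sval (L t))) by case: (svalP (L t)).
have EP t : projective (pe_mid (sval (E t))) by case: (svalP (E t)).
move=> WG.
pose l := fix l n : T := if n is m.+1 then exist W _ (LW (l m)) else exist W G WG.
pose r := fix r n : T := if n is m.+1 then exist W _ (EW (r m)) else exist W G WG.
pose lu n : {linear sval (l n.+1) -> _} := pc_in (sval (L (l n))).
pose lv n : {linear _ -> sval (l n)} := pc_out (sval (L (l n))).
pose ru n : {linear sval (r n) -> _} := pe_in (sval (E (r n))).
pose rv n : {linear _ -> sval (r n.+1)} := pe_out (sval (E (r n))).
have luv n : ses (lu n) (lv n) := LS (l n).
have ruv n : ses (ru n) (rv n) := ES (r n).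
have lvS n : surjective_map (lv n) by case: (luv n).
have rvS n : surjective_map (rv n) by case: (ruv n).
have luI n : injective (lu n) by case: (luv n).
have ruI n : injective (ru n) by case: (ruv n).
have luE n : extendable (lu n) := W_orthogonal (svalP (l n)) (luv n).
have ruE n : extendable (ru n) := W_orthogonal (svalP (r n.+1)) (ruv n).
(* G has to be the kernel of P_0 -> P^0, so P_0 is the first module of the
   sequence to the right of G, and P^0 the second. *)
exists (scons (pe_mid (sval (E (r 0%N)))) (fun n => pc_mid (sval (L (l n))))).
exists (fun n => pe_mid (sval (E (r n.+1)))).
exists (@chain_cons _ (fun n => pc_mid (sval (L (l n))))
  (ru 0%N \o lv 0%N : {linear _ -> _})
  (fun n => lu n \o lv n.+1 : {linear _ -> _})).
exists (ru 1%N \o rv 0%N : {linear _ -> _}).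
exists (fun n => ru n.+2 \o rv n.+1 : {linear _ -> _}).
split.
- by split=> [[|n]|n]; [apply: EP|apply: LP|apply: EP].
- split=> [[|n]|||n]; apply: splice_exact;
    by [exact: lvS|exact: rvS|exact: luv|exact: ruv|exact: luI|exact: ruI|
        exact: luE|exact: ruE].
- move=> X XXX; split=> [[|n]|||n]; apply: splice_hom_exact => //;
    by [exact: lvS|exact: rvS|exact: luv|exact: ruv|exact: luI|exact: ruI|
        exact: luE|exact: ruE].
- exists (ru 0%N); split=> [|b]; first exact: ruI.
  have [_ ex _] := ruv 0%N; apply: (iff_trans _ (ex b)).
  by split=> [/= e|/= ->]; [apply: (ruI 1%N); rewrite e linear0|rewrite linear0].
Qed.

End Coinduction.
End Gorenstein.

(** * Extensions, retracts and kernels of epimorphisms *)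

Section Closure.
Variables (R : nzRingType) (XX : lmodType R -> Prop).
Implicit Types A B C D G H K M N P Q X Y Z : lmodType R.

Lemma projective_Gproj P : projective P -> Gproj XX P.
Proof.
have [O O0] := trivial_exists R.
apply: Gproj_coind => {P} P pP.
- move=> A B u v [uI uv vS] X _ f.
  have [s sP] := pP B P v idfun vS.
  have [|p pE] := @factor_inj _ _ _ _ u (idfun \- (s \o v) : {linear _ -> _}) uI.
    by move=> b; apply/uv; rewrite /= linearB /= sP subrr.
  exists (f \o p : {linear _ -> _}) => a /=; congr (f _); apply: uI.
  by rewrite pE /= (_ : v (u a) = 0) ?linear0 ?addr0//; apply/uv; exists a.
- exists O, P, (\0 : {linear _ -> _}), idfun; split=> //; last exact: projective_trivial.
  split=> [x y _|b|b]; first by rewrite (O0 x) (O0 y).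
    by split=> /= [->|[_ <-]] //; exists 0.
  by exists b.
- exists P, O, idfun, (\0 : {linear _ -> _}); split=> //; last exact: projective_trivial.
  split=> // [b|b]; first by split=> // _; exists b.
  by exists 0; rewrite (O0 b).
Qed.

(** A map from D extends first to the preimage Z of A in Y, since Z is an
extension of A by D, then to Y, since Y is an extension of C by Z. *)
Lemma ext_orthogonal_extension A B C (u : {linear A -> B}) (v : {linear B -> C}) :
  ses u v -> ext_orthogonal XX A -> ext_orthogonal XX C -> ext_orthogonal XX B.
Proof.
move=> [uI uv vS] oA oC D Y i p [iI ip pS] X XXX f.
have [Z [j jvp]] : exists Z (j : {linear Z -> Y}), ses j (v \o p : {linear _ -> _}).
  apply: kernel_ses => c; have [b <-] := vS c; have [y <-] := pS b.
  by exists y.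
have [jI jvpE _] := jvp.
have [q qP] : exists q : {linear Z -> A}, forall z, u (q z) = p (j z).
  apply: (@factor_inj _ _ _ _ _ (p \o j : {linear _ -> _})) => // z.
  by apply/uv/jvpE; exists z.
have [k kP] : exists k : {linear D -> Z}, forall d, j (k d) = i d.
  apply: factor_inj => // d; apply/jvpE => /=.
  by rewrite (_ : p _ = 0) ?linear0//; apply/ip; exists d.
have kq : ses k q.
  split=> [x y e|z|a].
  - by apply: iI; rewrite -!kP e.
  - split=> [qz|[d <-]]; last first.
      by apply: uI; rewrite qP kP linear0; apply/ip; exists d.
    have /ip[d dz] : p (j z) = 0 by rewrite -qP qz linear0.
    by exists d; apply: jI; rewrite kP.
  - have [y ya] := pS (u a).
    have /jvpE[z zy] : (v \o p) y = 0 by rewrite /= ya; apply/uv; exists a.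
    by exists z; apply: uI; rewrite qP zy.
have [g gP] := oA _ _ _ _ kq X XXX f.
have [h hP] := oC _ _ _ _ jvp X XXX g.
by exists h => d; rewrite -kP hP gP.
Qed.

(** Pull an extension of C back along r to an extension Z of D: maps extend to
Z, and s lifts to a map from the extension of C to Z. *)
Lemma ext_orthogonal_retract C D (s : {linear C -> D}) (r : {linear D -> C}) :
  cancel s r -> ext_orthogonal XX D -> ext_orthogonal XX C.
Proof.
move=> sK oD A B u v [uI uv vS] X XXX f.
have [Z [j [jI jE]]] := kernel_exists (copair_map v r : {linear _ -> _}).
have [k kP] : exists k : {linear A -> Z}, forall a, j (k a) = pair_map u \0 a.
  apply: factor_inj => // a; apply/jE; rewrite /= /copair_map /= linear0 addr0.
  by apply/uv; exists a.
have [l lP] : exists l : {linear B -> Z}, forall b,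
    j (l b) = pair_map idfun (\- (s \o v)) b.
  apply: factor_inj => // b; apply/jE; rewrite /= /copair_map /=.
  by rewrite linearN /= sK subrr.
have kq : ses k (snd \o j : {linear _ -> _}).
  split=> [x y e|z|d].
  - by apply: uI; have := congr1 j e; rewrite !kP => -[].
  - split=> [/= jz|[a <-]]; last by rewrite /= kP.
    have : copair_map v r (j z) = 0 by apply/jE; exists z.
    rewrite /copair_map jz linear0 addr0 => /uv[a az].
    by exists a; apply: jI; rewrite kP /pair_map /= az [RHS]surjective_pairing jz.
  - have [b bd] := vS (- r d).
    have /jE[z zE] : copair_map v r (b, d) = 0 by rewrite /copair_map /= bd addNr.
    by exists z; rewrite /= zE.
have [g gP] := oD _ _ _ _ kq X XXX f.
exists (g \o l : {linear _ -> _}) => a /=; rewrite -gP; congr (g _).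
apply: jI; rewrite lP kP /pair_map /= (_ : v _ = 0) ?linear0 ?oppr0//.
by apply/uv; exists a.
Qed.

Hypothesis projXX : forall P, projective P -> XX P.

(** The horseshoe construction. On the left C lifts by projectivity; on the
right the embedding of A extends to B because its target, being projective, lies
in XX. *)
Lemma Gproj_extension A B C (u : {linear A -> B}) (v : {linear B -> C}) :
  ses u v -> Gproj XX A -> Gproj XX C -> Gproj XX B.
Proof.
move=> suv gA gC.
pose W B := exists A C (u : {linear A -> B}) (v : {linear B -> C}),
  [/\ ses u v, Gproj XX A & Gproj XX C].
have : W B by exists A, C, u, v.
apply: Gproj_coind => {A B C u v suv gA gC} B [A [C [u [v [suv gA gC]]]]].
- exact: ext_orthogonal_extension suv (Gproj_orthogonal gA) (Gproj_orthogonal gC).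
- have [uI uv vS] := suv.
  have [KA [PA [iA [pA [sA prA gKA _]]]]] := Gproj_left gA.
  have [KC [PC [iC [pC [sC prC gKC _]]]]] := Gproj_left gC.
  have [[iAI iAp pAS] [iCI iCp pCS]] := (sA, sC).
  have [l lP] := prC _ _ v pC vS.
  pose p := copair_map (u \o pA) l : {linear _ -> _}.
  have pS : surjective_map p.
    move=> b; have [c cb] := pCS (v b).
    have /uv[a ab] : v (b - l c) = 0 by rewrite linearB /= lP cb subrr.
    have [x xa] := pAS a.
    by exists (x, c); rewrite /p /= /copair_map /= xa ab subrK.
  have vp x : v (p x) = pC x.2.
    by rewrite /p /= /copair_map /= linearD /= (ses0 _ suv) add0r lP.
  have [K [j sj]] := kernel_ses pS; have [jI jE _] := sj.
  exists K, (PA * PC)%type, j, p; split=> //; first exact: projective_pair.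
  have [k kP] : exists k : {linear KA -> K}, forall x, j (k x) = pair_map iA \0 x.
    apply: factor_inj => // x; apply/jE; rewrite /p /= /copair_map /=.
    by rewrite linear0 addr0 (ses0 _ sA) linear0.
  have [q qP] : exists q : {linear K -> KC}, forall x, iC (q x) = (j x).2.
    apply: (@factor_inj _ _ _ _ _ (snd \o j : {linear _ -> _})) => // x.
    by apply/iCp; rewrite /= -vp (ses0 _ sj) linear0.
  exists KA, KC, k, q; split=> //; split.
  + by move=> x y e; apply: iAI; have := congr1 j e; rewrite !kP => -[].
  + move=> x; split=> [qx|[y <-]]; last by apply: iCI; rewrite qP kP linear0.
    have jx2 : (j x).2 = 0 by rewrite -qP qx linear0.
    have := ses0 x sj; rewrite /p /= /copair_map jx2 linear0 addr0 /= => e.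
    have /iAp[y yx] : pA (j x).1 = 0 by apply: uI; rewrite e linear0.
    by exists y; apply: jI; rewrite kP /pair_map /= yx -jx2 -surjective_pairing.
  + move=> y; have /uv[a ay] : v (l (iC y)) = 0 by rewrite lP (ses0 _ sC).
    have [x xa] := pAS (- a).
    have /jE[z zE] : p (x, iC y) = 0.
      by rewrite /p /= /copair_map /= xa linearN /= ay addNr.
    by exists z; apply: iCI; rewrite qP zE.
- have [uI uv vS] := suv.
  have [PA [CA [jA [qA [sA prA gCA]]]]] := Gproj_right gA.
  have [PC [CC [jC [qC [sC prC gCC]]]]] := Gproj_right gC.
  have [[jAI jAq qAS] [jCI jCq qCS]] := (sA, sC).
  have [e eP] := Gproj_orthogonal gC suv (projXX prA) jA.
  pose j := pair_map e (jC \o v) : {linear _ -> _}.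
  have jI : injective j.
    apply: linear_inj => b [eb vb].
    have /uv[a ab] : v b = 0 by apply: jCI; rewrite vb linear0.
    move: eb; rewrite -ab eP => ea; rewrite (_ : a = 0) ?linear0//.
    by apply: jAI; rewrite ea linear0.
  have [D [q sq]] := cokernel_exists jI; have [_ jq qS] := sq.
  exists (PA * PC)%type, D, j, q; split=> //; first exact: projective_pair.
  have [k kP] : exists k : {linear CA -> D}, forall x,
      k (qA x) = q (pair_map idfun \0 x).
    apply: (@factor_surj _ _ _ _ _ (q \o pair_map idfun \0 : {linear _ -> _})) => //.
    move=> x /jAq[a <-]; apply/jq; exists (u a).
    by rewrite /j /= /pair_map /= eP (ses0 _ suv) linear0.
  have [l lP] : exists l : {linear D -> CC}, forall x, l (q x) = qC x.2.
    apply: (@factor_surj _ _ _ _ _ (qC \o snd : {linear _ -> _})) => //.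
    by move=> x /jq[b <-]; rewrite /= (ses0 _ sC).
  exists CA, CC, k, l; split=> //; split.
  + apply: linear_inj => z; have [x <-] := qAS z.
    rewrite kP => /jq[b [eb vb]].
    have /uv[a ab] : v b = 0 by apply: jCI; rewrite vb linear0.
    by rewrite -eb -ab eP (ses0 _ sA).
  + move=> d; split=> [|[z <-]]; last first.
      by have [x <-] := qAS z; rewrite kP lP linear0.
    have [[x y] <-] := qS d; rewrite lP => /= /jCq[c cy].
    have [b bc] := vS c; exists (qA (x - e b)); rewrite kP.
    apply/eqP; rewrite -subr_eq0 -linearB; apply/eqP/jq; exists (- b).
    rewrite /j /= /pair_map /= -[RHS]/(x - e b - x, 0 - y) sub0r -cy -bc !linearN.
    by rewrite addrAC subrr sub0r.
  + move=> c; have [y <-] := qCS c; exists (q (0, y)); exact: lP.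
Qed.

(** The new kernel L (resp. cokernel N) of C becomes an extension of modules in
the class after adding C itself: 0 -> K -> L x C -> D -> 0 and
0 -> D -> N x C -> Q -> 0 are exact, where K (resp. Q) is the kernel (resp.
cokernel) that D has in the class. *)
Lemma Gproj_retract C D (s : {linear C -> D}) (r : {linear D -> C}) :
  cancel s r -> Gproj XX D -> Gproj XX C.
Proof.
move=> sK gD.
pose W C := exists D (s : {linear C -> D}) (r : {linear D -> C}),
  cancel s r /\ Gproj XX D.
have : W C by exists D, s, r.
apply: Gproj_coind => {C D s r sK gD} C [D [s [r [sK gD]]]].
- exact: ext_orthogonal_retract sK (Gproj_orthogonal gD).
- have [K [P [i [p [sip prP gK _]]]]] := Gproj_left gD.
  have [iI ip pS] := sip.
  have rpS : surjective_map (r \o p : {linear _ -> _}).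
    by move=> c; have [x xc] := pS (s c); exists x; rewrite /= xc sK.
  have [L [j sj]] := kernel_ses rpS; have [jI jE _] := sj.
  have rpj x : r (p (j x)) = 0 := ses0 x sj.
  exists L, P, j, (r \o p : {linear _ -> _}); split=> //.
  exists (L * C)%type, (pair_map idfun \0 : {linear _ -> _}), fst; split=> //.
  have [k kP] : exists k : {linear K -> L}, forall x, j (k x) = i x.
    by apply: factor_inj => // x; apply/jE; rewrite /= (ses0 _ sip) linear0.
  apply: (@Gproj_extension K _ D (pair_map k \0 : {linear _ -> _})
    (copair_map (p \o j) s : {linear _ -> _})) => //; split.
  + by move=> x y [e]; apply: iI; rewrite -!kP e.
  + move=> [x c]; split=> [|[y [<- <-]]]; rewrite /= /copair_map /=; last first.
      by rewrite linear0 addr0 kP (ses0 _ sip).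
    move=> e; have c0 : c = 0.
      by have := congr1 r e; rewrite linearD /= sK rpj add0r linear0.
    move: e; rewrite c0 linear0 addr0 => /ip[y yx].
    by exists y; rewrite /pair_map /=; congr pair; apply: jI; rewrite kP.
  + move=> d; have [y yd] := pS (d - s (r d)).
    have /jE[x xy] : (r \o p) y = 0 by rewrite /= yd linearB /= sK subrr.
    by exists (x, r d); rewrite /= /copair_map /= xy yd subrK.
- have [P [Q [i [p [sip prP gQ]]]]] := Gproj_right gD.
  have [iI ip pS] := sip.
  have isI : injective (i \o s : {linear _ -> _}).
    by apply: inj_comp => //; exact: can_inj sK.
  have [N [q sq]] := cokernel_exists isI; have [_ qE qS] := sq.
  exists P, N, (i \o s : {linear _ -> _}), q; split=> //.
  exists (N * C)%type, (pair_map idfun \0 : {linear _ -> _}), fst; split=> //.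
  have [l lP] : exists l : {linear N -> Q}, forall x, l (q x) = p x.
    by apply: factor_surj => // x /qE[c <-]; rewrite /= (ses0 _ sip).
  apply: (@Gproj_extension D _ Q (pair_map (q \o i) r : {linear _ -> _})
    (l \o fst : {linear _ -> _})) => //; split.
  + apply: linear_inj => d [/= /qE[c /= /iI cd]] rd.
    by move: rd; rewrite -cd sK => ->; rewrite linear0.
  + move=> [n c]; split=> [|[d [<- _]]]; rewrite /=; last by rewrite lP (ses0 _ sip).
    have [x <-] := qS n; rewrite lP => /ip[d dx].
    have rE : r (d - s (r d) + s c) = c.
      by rewrite linearD linearB /= !sK subrr add0r.
    exists (d - s (r d) + s c); rewrite /= /pair_map /= rE -dx; congr pair.
    apply/eqP; rewrite -subr_eq0 -linearB; apply/eqP/qE; exists (c - r d).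
    by rewrite /= -linearB; congr (i _); rewrite addrAC (addrC d) addrK addrC linearB.
  + by move=> z; have [x xz] := pS z; exists (q x, 0); rewrite /= lP.
Qed.

(** For Q projective with a map p onto B and kernel L, the module
Z = {(a, x) | v a + p x = 0} is an extension of A by L. A lift l of p through v
retracts Z onto K by (a, x) |-> a + l x. *)
Lemma Gproj_kernel K A B (u : {linear K -> A}) (v : {linear A -> B}) :
  ses u v -> Gproj XX A -> Gproj XX B -> Gproj XX K.
Proof.
move=> suv gA gB; have [uI uv vS] := suv.
have [L [Q [i [p [sip prQ gL _]]]]] := Gproj_left gB.
have [iI ip pS] := sip.
have [l lP] := prQ _ _ v p vS.
have [Z [j [jI jE]]] := kernel_exists (copair_map v p : {linear _ -> _}).
have gZ : Gproj XX Z.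
  have [k kP] : exists k : {linear L -> Z}, forall x, j (k x) = pair_map \0 i x.
    apply: factor_inj => // x; apply/jE; rewrite /= /copair_map /= linear0 add0r.
    exact: ses0 sip.
  apply: (@Gproj_extension L _ A k (fst \o j : {linear _ -> _})) => //; split.
  - by move=> x y e; apply: iI; have := congr1 j e; rewrite !kP => -[].
  - move=> z; split=> [/= jz|[x <-]]; last by rewrite /= kP.
    have : copair_map v p (j z) = 0 by apply/jE; exists z.
    rewrite /copair_map jz linear0 add0r => /ip[x xz].
    by exists x; apply: jI; rewrite kP /pair_map /= xz [RHS]surjective_pairing jz.
  - move=> a; have [x xa] := pS (- v a).
    have /jE[z zE] : copair_map v p (a, x) = 0 by rewrite /copair_map /= xa subrr.
    by exists z; rewrite /= zE.
have [s sP] : exists s : {linear K -> Z}, forall x, j (s x) = pair_map u \0 x.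
  apply: factor_inj => // x; apply/jE; rewrite /= /copair_map /= linear0 addr0.
  exact: ses0 suv.
have [r rP] : exists r : {linear Z -> K}, forall z, u (r z) = (copair_map idfun l \o j) z.
  apply: factor_inj => // z; apply/uv; rewrite /= /copair_map /= linearD /= lP.
  by have /jE := ex_intro (fun x => j x = j z) z erefl.
apply: (Gproj_retract (s := s) (r := r)) gZ => x.
by apply: uI; rewrite rP /= sP /copair_map /= linear0 addr0.
Qed.

End Closure.

(** * Direct sums *)

Section DirectSums.
Variables (R : nzRingType) (I : Type).
Implicit Types (M N K P : I -> lmodType R) (X : lmodType R).

Lemma dirsum_ext M (x y : dirsum M) :
  (forall i, dirsum_val x i = dirsum_val y i) -> x = y.
Proof. by move=> e; apply: val_inj; exact: functional_extensionality_dep. Qed.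

Definition dirsum_proj M i (x : dirsum M) : M i := dirsum_val x i.

Fact dirsum_proj_is_linear M i : linear (@dirsum_proj M i).
Proof. by []. Qed.

HB.instance Definition _ M i := GRing.isLinear.Build R (dirsum M) (M i) *:%R
  (@dirsum_proj M i) (@dirsum_proj_is_linear M i).

Definition single_fun M i (x : M i) : dirprod M := fun j =>
  if pselect (i = j) is left e then ecast j (M j) e x else 0.

Fact single_fun_finsupp M i (x : M i) : single_fun x \in dirprod_finsupp (M:=M).
Proof.
apply/asboolP; apply: (sub_finite_set _ (finite_set1 i)) => j /=.
by rewrite /single_fun; case: pselect => [e _|]; rewrite ?eqxx.
Qed.

Definition dirsum_inj M i (x : M i) : dirsum M := DirSum (single_fun_finsupp x).

Lemma dirsum_injE M i (x : M i) : dirsum_val (dirsum_inj x) i = x.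
Proof.
by rewrite /= /single_fun; case: pselect => // e; rewrite (Prop_irrelevance e erefl).
Qed.

Lemma dirsum_inj_neq M i j (x : M i) : i <> j -> dirsum_val (dirsum_inj x) j = 0.
Proof. by move=> ij; rewrite /= /single_fun; case: pselect. Qed.

Fact dirsum_inj_is_linear M i : linear (@dirsum_inj M i).
Proof.
move=> a x y; apply: dirsum_ext => j.
rewrite -[RHS]/(a *: dirsum_val (dirsum_inj x) j + dirsum_val (dirsum_inj y) j).
case: (pselect (i = j)) => [<-|ij].
  by rewrite !dirsum_injE.
by rewrite !dirsum_inj_neq// scaler0 addr0.
Qed.

HB.instance Definition _ M i := GRing.isLinear.Build R (M i) (dirsum M) *:%R
  (@dirsum_inj M i) (@dirsum_inj_is_linear M i).

(** Finite sums over the support need an index type with decidable equality,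
hence [{classic I}]. *)
Definition covers M (s : seq {classic I}) (x : dirsum M) : Prop :=
  uniq s /\ forall i : {classic I}, dirsum_val x i != 0 -> i \in s.

Lemma covers_exists M (x : dirsum M) : exists s, covers s x.
Proof.
have /asboolP : dirsum_val x \in dirprod_finsupp (M:=M) by case: x.
move=> /(@finite_seqP {classic I})[s sE]; exists (undup s).
split=> [|i xi]; first exact: undup_uniq.
have : [set` s] i by rewrite -sE.
by rewrite mem_undup.
Qed.

Lemma covers_cat M s t (x : dirsum M) :
  covers s x \/ covers t x -> covers (undup (s ++ t)) x.
Proof.
move=> st; split=> [|i xi]; first exact: undup_uniq.
rewrite mem_undup mem_cat; apply/orP.
by case: st => -[_ h]; [left|right]; exact: h.
Qed.

Lemma covers_sum M X (h : forall i, {linear M i -> X}) s t (x : dirsum M) :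
  covers s x -> covers t x ->
  \sum_(i <- s) h i (dirsum_val x i) = \sum_(i <- t) h i (dirsum_val x i).
Proof.
suff E r : \sum_(i <- r) h i (dirsum_val x i) =
    \sum_(i <- [seq i : {classic I} <- r | dirsum_val x i != 0])
      h i (dirsum_val x i).
  move=> [us xs] [ut xt]; rewrite [LHS]E [RHS]E; apply: perm_big.
  apply: uniq_perm => [||i]; rewrite ?filter_uniq// !mem_filter.
  by case: (boolP (dirsum_val x i != 0)) => //= xi; rewrite xs ?xt.
rewrite big_filter [RHS]big_mkcond; apply: eq_bigr => i _.
by case: eqP => //= ->; rewrite linear0.
Qed.

Lemma dirsum_decomp M s (x : dirsum M) : covers s x ->
  x = \sum_(i <- s) dirsum_inj (dirsum_val x i).
Proof.
move=> [us xs]; apply: dirsum_ext => j.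
have -> : dirsum_val (\sum_(i <- s) dirsum_inj (dirsum_val x i)) j =
    \sum_(i <- s) dirsum_val (dirsum_inj (dirsum_val x i)) j.
  exact: (linear_sum (@dirsum_proj M j)).
have [js|js] := boolP ((j : {classic I}) \in s).
  rewrite (bigD1_seq (j : {classic I})) // dirsum_injE.
  rewrite big1 => [/=|i /eqP ij]; first by rewrite addr0.
  exact: dirsum_inj_neq.
rewrite big1_seq => [|i /andP[_ si]].
  by apply/eqP; apply: contraNT js => /xs.
by apply: dirsum_inj_neq => ij; move: js; rewrite -ij si.
Qed.

Lemma dirsum_hom_ext M X (f g : {linear dirsum M -> X}) :
  (forall i (x : M i), f (dirsum_inj x) = g (dirsum_inj x)) -> f =1 g.
Proof.
move=> e x; have [s sx] := covers_exists x.
by rewrite (dirsum_decomp sx) !linear_sum; apply: eq_bigr => i _; exact: e.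
Qed.

(** The universal property, the uniqueness being [dirsum_hom_ext]. *)
Lemma dirsum_copair M X (h : forall i, {linear M i -> X}) :
  exists g : {linear dirsum M -> X}, forall i (x : M i), g (dirsum_inj x) = h i x.
Proof.
have gE x : exists y, forall s, covers s x ->
    y = \sum_(i <- s) h i (dirsum_val x i).
  have [s sx] := covers_exists x.
  by exists (\sum_(i <- s) h i (dirsum_val x i)) => t tx; exact: covers_sum.
have [g gP] := choice gE.
have lg : linear g.
  move=> a x y; have [[s sx] [t ty]] := (covers_exists x, covers_exists y).
  have [r rz] := covers_exists (a *: x + y).
  pose w := undup (undup (s ++ t) ++ r).
  rewrite (gP _ w); last by apply: covers_cat; right.
  rewrite (gP x w); last by apply: covers_cat; left; apply: covers_cat; left.
  rewrite (gP y w); last by apply: covers_cat; left; apply: covers_cat; right.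
  rewrite scaler_sumr -big_split; apply: eq_bigr => i _ /=.
  by rewrite -linearP.
exists (linear_of lg) => i x; rewrite /= (gP _ [:: i]) ?big_seq1 ?dirsum_injE//.
split=> // j; rewrite inE => xj; apply/eqP/esym.
have [//|ij] := pselect (i = j).
by move: xj; rewrite dirsum_inj_neq ?eqxx.
Qed.

Lemma dirsum_map M N (f : forall i, {linear M i -> N i}) :
  exists F : {linear dirsum M -> dirsum N},
    forall x i, dirsum_val (F x) i = f i (dirsum_val x i).
Proof.
have [F FP] := dirsum_copair (fun i => @dirsum_inj N i \o f i : {linear _ -> _}).
exists F => x i.
apply: (@dirsum_hom_ext M _ (dirsum_proj i \o F : {linear _ -> _})
  (f i \o dirsum_proj i : {linear _ -> _})) => j y.
rewrite -[RHS]/(f i (dirsum_val (dirsum_inj y) i)).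
rewrite -[LHS]/(dirsum_val (F (dirsum_inj y)) i) FP.
rewrite -[LHS]/(dirsum_val (dirsum_inj (f j y)) i).
case: (pselect (j = i)) => [<-|ji].
  by rewrite !dirsum_injE.
by rewrite !dirsum_inj_neq// linear0.
Qed.

(** Choosing 0 above every zero entry keeps the support finite. *)
Lemma dirsum_lift M N (f : forall i, {linear M i -> N i}) (y : dirsum N) :
  (forall i, exists x, f i x = dirsum_val y i) ->
  exists x : dirsum M, forall i, f i (dirsum_val x i) = dirsum_val y i.
Proof.
move=> h.
have {}h i : exists x, f i x = dirsum_val y i /\ (dirsum_val y i = 0 -> x = 0).
  have [y0|y0] := eqVneq (dirsum_val y i) 0.
    by exists 0; rewrite y0 linear0.
  by have [x xy] := h i; exists x; split=> // /eqP; rewrite (negbTE y0).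
pose x i := sval (cid (h i)).
have xf : (x : dirprod M) \in dirprod_finsupp (M:=M).
  have /asboolP yf : dirsum_val y \in dirprod_finsupp (M:=N) by case: (y).
  apply/asboolP; apply: sub_finite_set yf => i /=; apply: contra_neq => yi.
  by rewrite /x; case: cid => z /= [_]; exact.
exists (DirSum xf) => i /=; rewrite /x; by case: cid => z /= [].
Qed.

Lemma dirsum_ses K M N (u : forall i, {linear K i -> M i})
    (v : forall i, {linear M i -> N i}) :
  (forall i, ses (u i) (v i)) ->
  exists (U : {linear dirsum K -> dirsum M}) (V : {linear dirsum M -> dirsum N}),
    ses U V /\ forall x i, dirsum_val (U x) i = u i (dirsum_val x i).
Proof.
move=> s; have [[U UP] [V VP]] := (dirsum_map u, dirsum_map v).
exists U, V; split=> //; split.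
- move=> x y e; apply: dirsum_ext => i; have [uI _ _] := s i.
  by apply: uI; rewrite -!UP e.
- move=> y; split=> [Vy|[x <-]].
    have [i|x xy] := @dirsum_lift _ _ u y; last first.
      by exists x; apply: dirsum_ext => i; rewrite UP xy.
    by have [_ uv _] := s i; apply/uv; rewrite -VP Vy.
  by apply: dirsum_ext => i; rewrite VP UP (ses0 _ (s i)).
- move=> z; have [i|x xz] := @dirsum_lift _ _ v z; last first.
    by exists x; apply: dirsum_ext => i; rewrite VP xz.
  by have [_ _ vS] := s i; exact: vS.
Qed.

Lemma projective_dirsum P : (forall i, projective (P i)) -> projective (dirsum P).
Proof.
move=> pP A B g f gS.
have h i := cid (pP i A B g (f \o @dirsum_inj P i : {linear _ -> _}) gS).
have [k kP] := dirsum_copair (fun i => sval (h i)).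
exists k; apply: (@dirsum_hom_ext P _ (g \o k : {linear _ -> _})) => i x.
by rewrite /= kP (svalP (h i)).
Qed.

Variable XX : lmodType R -> Prop.

Lemma extendable_dirsum K P (u : forall i, {linear K i -> P i})
    (U : {linear dirsum K -> dirsum P}) :
  (forall x i, dirsum_val (U x) i = u i (dirsum_val x i)) ->
  (forall i, extendable XX (u i)) -> extendable XX U.
Proof.
move=> UP uE X XXX f.
have h i := cid (uE i X XXX (f \o @dirsum_inj K i : {linear _ -> _})).
have [k kP] := dirsum_copair (fun i => sval (h i)).
exists k; apply: (@dirsum_hom_ext K _ (k \o U : {linear _ -> _})) => i x /=.
rewrite (_ : U _ = dirsum_inj (u i x)) ?kP ?(svalP (h i))//.
apply: dirsum_ext => j; rewrite UP; case: (pselect (i = j)) => [<-|ij].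
  by rewrite !dirsum_injE.
by rewrite !dirsum_inj_neq// linear0.
Qed.

(** Coinduction on the class of sums, indexed by I, of modules in the class: the
sum of the projective sequences of the summands serves on either side. *)
Lemma Gproj_dirsum M : (forall i, Gproj XX (M i)) -> Gproj XX (dirsum M).
Proof.
move=> gM.
pose W (G : lmodType R) := exists M, (forall i, Gproj XX (M i)) /\ G = dirsum M.
have : W (dirsum M) by exists M.
apply: Gproj_coind => {M gM} _ [M [gM ->]].
- have L i : {p : precover (M i) | [/\ ses (pc_in p) (pc_out p),
      projective (pc_mid p) & extendable XX (pc_in p)]}.
    apply: cid; have [K [P [u [v [s pP _ e]]]]] := Gproj_left (gM i).
    by exists (Precover u v).
  have [|U [V [sUV UE]]] := @dirsum_ses _ _ _
      (fun i => pc_in (sval (L i))) (fun i => pc_out (sval (L i))).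
    by move=> i; case: (svalP (L i)).
  apply: ext_orthogonal_presentation sUV _ _.
    by apply: projective_dirsum => i; case: (svalP (L i)).
  by apply: extendable_dirsum UE _ => i; case: (svalP (L i)).
- have L i : {p : precover (M i) | [/\ ses (pc_in p) (pc_out p),
      projective (pc_mid p) & Gproj XX (pc_ker p)]}.
    apply: cid; have [K [P [u [v [s pP g _]]]]] := Gproj_left (gM i).
    by exists (Precover u v).
  have [|U [V [sUV _]]] := @dirsum_ses _ _ _
      (fun i => pc_in (sval (L i))) (fun i => pc_out (sval (L i))).
    by move=> i; case: (svalP (L i)).
  exists (dirsum (fun i => pc_ker (sval (L i)))).
  exists (dirsum (fun i => pc_mid (sval (L i)))), U, V; split=> //.
    by apply: projective_dirsum => i; case: (svalP (L i)).
  exists (fun i => pc_ker (sval (L i))); split=> // i.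
  by case: (svalP (L i)).
- have L i : {p : preenvelope (M i) | [/\ ses (pe_in p) (pe_out p),
      projective (pe_mid p) & Gproj XX (pe_coker p)]}.
    apply: cid; have [P [C [u [v [s pP g]]]]] := Gproj_right (gM i).
    by exists (Preenvelope u v).
  have [|U [V [sUV _]]] := @dirsum_ses _ _ _
      (fun i => pe_in (sval (L i))) (fun i => pe_out (sval (L i))).
    by move=> i; case: (svalP (L i)).
  exists (dirsum (fun i => pe_mid (sval (L i)))).
  exists (dirsum (fun i => pe_coker (sval (L i)))), U, V; split=> //.
    by apply: projective_dirsum => i; case: (svalP (L i)).
  exists (fun i => pe_coker (sval (L i))); split=> // i.
  by case: (svalP (L i)).
Qed.

End DirectSums.

(** * Gorenstein dimension *)

Section Dimension.
Variables (R : nzRingType) (XX : lmodType R -> Prop).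
Hypothesis projXX : forall P : lmodType R, projective P -> XX P.
Implicit Types A B C D G K M P T : lmodType R.

(** Resolutions of length n, read one syzygy at a time so that proofs can go by
induction on n. *)
Fixpoint Gdim_le (n : nat) M : Prop :=
  if n is m.+1 then
    exists K G (u : {linear K -> G}) (v : {linear G -> M}),
    [/\ ses u v, Gproj XX G & Gdim_le m K]
  else Gproj XX M.

Lemma Gproj_resolutionP n M : Gproj_resolution XX M n <-> Gdim_le n M.
Proof.
elim: n M => [|n IH] M; split.
- move=> [G [d [e [gG tG _ de eS]]]].
  have eI : injective e.
    by apply: linear_inj => x /de[y <-]; rewrite (tG 1%N _ y) ?linear0.
  have [s sP] := @factor_inj _ _ _ _ e idfun eI eS.
  by apply: (Gproj_retract projXX (s := s) (r := e)) => //; exact: gG.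
- move=> gM; have [O O0] := trivial_exists R.
  exists (scons M (fun=> O)), (chain_cons (\0 : {linear O -> M}) (fun=> \0)), idfun.
  split=> [[|k]//|[|k]//|k y|y|y]; last by exists y.
    by split=> _; [exists 0; rewrite (O0 y) linear0|rewrite (O0 y) linear0].
  by split=> [/= ->|[z <-]]//; exists 0.
- move=> [G [d [e [gG tG dd de eS]]]].
  have [K [j sj]] := kernel_ses eS; have [jI je _] := sj.
  have [w wP] : exists w : {linear G 1%N -> K}, forall x, j (w x) = d 0%N x.
    by apply: factor_inj => // x; apply/je/de; exists x.
  exists K, (G 0%N), j, e; split=> //; first exact: gG.
  apply/IH; exists (G \o succn), (fun k => d k.+1), w; split.
  + by move=> k kn; exact: gG.
  + by move=> k kn; exact: tG.
  + by move=> k; exact: dd.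
  + move=> b; apply: (iff_trans _ (dd 0%N b)); rewrite -wP.
    by split=> [->|]; [exact: linear0|move=> e0; apply: jI; rewrite e0 linear0].
  + move=> k; have /de[b bk] : e (j k) = 0 by exact: ses0 sj.
    by exists b; apply: jI; rewrite wP.
- move=> [K [G [u [v [suv gG /IH[Gs [d [e [gGs tGs dd de eS]]]]]]]]].
  have [uI uv vS] := suv.
  exists (scons G Gs), (chain_cons (u \o e : {linear _ -> _}) d), v; split=> //.
  + by move=> [|k] //; exact: gGs.
  + by move=> [|k] //; exact: tGs.
  + move=> [|k]; last exact: dd.
    move=> b; apply: (iff_trans _ (de b)) => /=.
    by split=> [e0|->]; [apply: uI; rewrite e0 linear0|rewrite linear0].
  + move=> b; apply: (iff_trans (uv b)); split=> [[a <-]|[x <-]]; last by exists (e x).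
    by have [x <-] := eS a; exists x.
Qed.

Lemma Gdim_leS n M : Gdim_le n M -> Gdim_le n.+1 M.
Proof.
elim: n M => [|n IH] M.
  move=> gM; have [O O0] := trivial_exists R.
  exists O, M, (\0 : {linear _ -> _}), idfun; split=> //.
    split=> [x y _|b|b]; first by rewrite (O0 x) (O0 y).
      by split=> /= [->|[_ <-]] //; exists 0.
    by exists b.
  by apply: projective_Gproj; exact: projective_trivial.
by move=> [K [G [u [v [suv gG /IH dK]]]]]; exists K, G, u, v.
Qed.

Lemma Gdim_le_mono m n M : (m <= n)%N -> Gdim_le m M -> Gdim_le n M.
Proof.
move=> /subnK <-; elim: (n - m)%N => // k IH /IH.
exact: Gdim_leS.
Qed.

Lemma Gdim_le_dirsum n (I : Type) (M : I -> lmodType R) :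
  (forall i, Gdim_le n (M i)) -> Gdim_le n (dirsum M).
Proof.
elim: n M => [|n IH] M; first exact: Gproj_dirsum.
move=> dM.
have L i : {p : precover (M i) | [/\ ses (pc_in p) (pc_out p),
    Gproj XX (pc_mid p) & Gdim_le n (pc_ker p)]}.
  by apply: cid; have [K [G [u [v s]]]] := dM i; exists (Precover u v).
have [|U [V [sUV _]]] := @dirsum_ses _ _ _ _ _
    (fun i => pc_in (sval (L i))) (fun i => pc_out (sval (L i))).
  by move=> i; case: (svalP (L i)).
exists (dirsum (fun i => pc_ker (sval (L i)))).
exists (dirsum (fun i => pc_mid (sval (L i)))), U, V; split=> //.
  by apply: Gproj_dirsum => i; case: (svalP (L i)).
by apply: IH => i; case: (svalP (L i)).
Qed.

Lemma Gproj_pair A B : Gproj XX A -> Gproj XX B -> Gproj XX (A * B)%type.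
Proof.
apply: (@Gproj_extension _ _ projXX _ _ _ (pair_map idfun \0 : {linear _ -> _})
  (snd : {linear _ -> _})).
split=> [x y []|[a b]|b] //; last by exists (0, b).
by split=> /= [->|[_ [_ <-]]]//; exists a.
Qed.

(** With l : P -> G lifting q, the map (x, y) |-> i x + l y from K x P onto G
has kernel T, which settles n = 0. If L -> H -> K starts a resolution of K, the
kernel U of the induced map H x P -> G is Gorenstein projective and maps onto T
with kernel L: only the first term of the resolution of K changes. *)
Lemma Gdim_le_syzygy n K G D (i : {linear K -> G}) (p : {linear G -> D})
    T P (j : {linear T -> P}) (q : {linear P -> D}) :
  ses i p -> Gproj XX G -> Gdim_le n K ->
  ses j q -> projective P -> Gdim_le n T.
Proof.
move=> sip gG dK sjq prP; have [[iI ip pS] [jI jq qS]] := (sip, sjq).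
have [l lP] := prP _ _ p q pS.
have gP := projective_Gproj XX prP.
have [k kP] : exists k : {linear T -> K}, forall t, i (k t) = l (j t).
  apply: (@factor_inj _ _ _ _ _ (l \o j : {linear _ -> _})) => // t.
  by apply/ip; rewrite /= lP (ses0 _ sjq).
have cover A (b : {linear A -> K}) : surjective_map b ->
    surjective_map (copair_map (i \o b) l).
  move=> bS g; have [x xg] := qS (p g).
  have /ip[y yg] : p (g - l x) = 0 by rewrite linearB /= lP xg subrr.
  by have [a ay] := bS y; exists (a, x); rewrite /copair_map /= ay yg subrK.
case: n dK => [gK|n [L [H [a [b [sab gH dL]]]]]].
  apply: (@Gproj_kernel _ _ projXX _ _ _ (pair_map (\- k) j : {linear _ -> _})
    (copair_map (i \o idfun) l : {linear _ -> _})) gG => //; last exact: Gproj_pair.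
  split=> [x y []|[y x]|]; first by move=> _ /jI.
    split=> [|[t [<- <-]]]; rewrite /= /copair_map /=; last by rewrite linearN /= kP addNr.
    move=> e; have /jq[t tx] : q x = 0.
      by have := congr1 p e; rewrite linearD /= (ses0 _ sip) add0r lP linear0.
    exists t; rewrite /pair_map /= tx; congr pair; apply: iI.
    by apply/eqP; rewrite linearN /= kP tx eq_sym -subr_eq0 opprK e.
  by apply: cover => y; exists y.
have [aI ab bS] := sab.
have [U [h sh]] := kernel_ses (cover _ _ bS : surjective_map
  (copair_map (i \o b) l : {linear _ -> _})).
have [hI hE _] := sh.
have hP x : i (b (h x).1) + l (h x).2 = 0 := ses0 x sh.
have [f fP] : exists f : {linear L -> U}, forall x, h (f x) = pair_map a \0 x.
  apply: factor_inj => // x; apply/hE.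
  by rewrite /= /copair_map /= (ses0 _ sab) !linear0 addr0.
have [g gE] : exists g : {linear U -> T}, forall x, j (g x) = (h x).2.
  apply: (@factor_inj _ _ _ _ _ (snd \o h : {linear _ -> _})) => // x.
  apply/jq; have := congr1 p (hP x).
  by rewrite linearD /= (ses0 _ sip) add0r lP linear0.
exists L, U, f, g; split=> //; last first.
  by apply: (Gproj_kernel projXX sh) => //; exact: Gproj_pair.
split.
- by move=> x y e; apply: aI; have := congr1 h e; rewrite !fP => -[].
- move=> x; split=> [gx|[y <-]]; last by apply: jI; rewrite gE fP linear0.
  have x2 : (h x).2 = 0 by rewrite -gE gx linear0.
  have := hP x; rewrite x2 linear0 addr0 => ib.
  have /ab[y yx] : b (h x).1 = 0 by apply: iI; rewrite ib linear0.
  by exists y; apply: hI; rewrite fP /pair_map /= yx [RHS]surjective_pairing x2.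
- move=> t; have [z zt] := bS (- k t).
  have /hE[x xz] : copair_map (i \o b) l (z, j t) = 0.
    by rewrite /copair_map /= zt linearN /= kP addNr.
  by exists x; apply: jI; rewrite gE xz.
Qed.

Lemma Gdim_le_retract n C D (s : {linear C -> D}) (r : {linear D -> C}) :
  cancel s r -> Gdim_le n D -> Gdim_le n C.
Proof.
elim: n C D s r => [|n IH] C D s r sK; first exact: Gproj_retract sK.
move=> [K [G [i [p [sip gG dK]]]]]; have [_ _ pS] := sip.
have [_ [P [_ [c [[_ _ cS] prP _ _]]]]] := Gproj_left gG.
pose q := p \o c : {linear _ -> _}.
have qS : surjective_map q.
  by move=> d; have [g <-] := pS d; have [x <-] := cS g; exists x.
have rqS : surjective_map (r \o q : {linear _ -> _}).
  by move=> y; have [x xy] := qS (s y); exists x; rewrite -[LHS]/(r (q x)) xy sK.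
have [L [j sj]] := kernel_ses rqS; have [jI jE _] := sj.
have rqj x : r (q (j x)) = 0 := ses0 x sj.
(* A map onto D that is compatible with the splitting of D by s and r, so that
   the kernel L of r q is a retract of its kernel T. *)
pose t := copair_map (s \o (r \o q)) (q \- (s \o (r \o q))) : {linear _ -> _}.
have tE x y : t (x, y) = s (r (q x)) + (q y - s (r (q y))) by [].
have tS : surjective_map t.
  by move=> d; have [x <-] := qS d; exists (x, x); rewrite tE addrC subrK.
have [T [h sh]] := kernel_ses tS; have [hI hE _] := sh.
have dT : Gdim_le n T.
  by apply: Gdim_le_syzygy sip gG dK sh _; exact: projective_pair.
exists L, P, j, (r \o q : {linear _ -> _}); split=> //.
  exact: projective_Gproj.
have [f fP] : exists f : {linear L -> T}, forall x, h (f x) = pair_map j \0 x.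
  apply: factor_inj => // x; apply/hE.
  by rewrite /= /pair_map tE rqj !linear0 !addr0.
have [g gP] : exists g : {linear T -> L}, forall x, j (g x) = (h x).1.
  apply: (@factor_inj _ _ _ _ _ (fst \o h : {linear _ -> _})) => // x; apply/jE.
  have := congr1 r (ses0 x sh); rewrite [h x]surjective_pairing tE.
  by rewrite linearD linearB /= !sK subrr addr0 linear0.
by apply: (IH _ _ f g) dT => x; apply: jI; rewrite gP fP.
Qed.

Lemma le_Gpd n M : le_natbar (Gpd XX M) (Nfin n) <-> Gdim_le n M.
Proof.
split=> [|dM]; last by apply: natbar_inf_lb; exact/Gproj_resolutionP.
rewrite /Gpd /natbar_inf; case: pselect => //= exA.
by case: ex_minnP => m /asboolP/Gproj_resolutionP dM _ /Gdim_le_mono; exact.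
Qed.

End Dimension.

Lemma natbar_eq x y :
  (forall n, le_natbar x (Nfin n) <-> le_natbar y (Nfin n)) -> x = y.
Proof.
case: x => [m|]; case: y => [n|] //= h.
- by congr Nfin; apply/eqP; rewrite eqn_leq; apply/andP; split; apply/h.
- by have := leqnn m => /h.
- by have := leqnn n => /h.
Qed.

Theorem proposition3p4 (R : nzRingType) (XX : lmodType R -> Prop)
    (projXX : forall P : lmodType R, projective P -> XX P)
    (I : Type) (M : I -> lmodType R) :
  Gpd XX (dirsum M) = natbar_sup [set Gpd XX (M i) | i in [set: I]].
Proof.
apply: natbar_eq => n; split=> [/le_Gpd dM|le_n].
  apply: natbar_sup_lub => _ [i _ <-]; apply/le_Gpd => //.
  apply: (Gdim_le_retract projXX (s := @dirsum_inj R I M i)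
    (r := @dirsum_proj R I M i)) (dM projXX) => x.
  exact: dirsum_injE.
apply/le_Gpd => //; apply: Gdim_le_dirsum => i; apply/le_Gpd => //.
have : le_natbar (Gpd XX (M i)) (natbar_sup [set Gpd XX (M i) | i in [set: I]]).
  by apply: natbar_sup_ub; exists i.
move: le_n; case: (natbar_sup _) => //= m.
by case: (Gpd _ _) => //= k mn /leq_trans; exact.
Qed.
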